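(* Let $G=(V,E)$ be a finite undirected graph with $N=|V|$ nodes whose node set is partitioned into a set $\mathcal{C}$ of categories, let $A,B\in\mathcal{C}$ with $A\neq B$, and let $S$ be a weighted independence sample of size $n$ from $V$, in which every node $v\in V$ is sampled with probability proportional to a known weight $\mathrm{w}(v)$. For the category size estimators $|\widehat{A}|$ and $|\widehat{B}|$ one can choose to plug in either the weighted induced-subgraph formula $$|\widehat{C}|=N\cdot\frac{\mathrm{w}_{-1}(S_C)}{\mathrm{w}_{-1}(S)}$$ or the weighted star formula $$|\widehat{C}|=N\cdot\widehat{f}^{\mathrm{vol}}_C\cdot\frac{\widehat{k}_V}{\widehat{k}_C},$$ where (with $C=A$ or $C=B$) $$\widehat{k}_V=\frac{\sum_{v\in S}\frac{\deg(v)}{\mathrm{w}(v)}}{\mathrm{w}_{-1}(S)},\quad \widehat{k}_C=\frac{\sum_{v\in S_C}\frac{\deg(v)}{\mathrm{w}(v)}}{\mathrm{w}_{-1}(S_C)},\quad \widehat{f}^{\mathrm{vol}}_C=\frac{1}{\sum_{s\in S}\frac{\deg(s)}{\mathrm{w}(s)}}\sum_{s\in S}\left(\frac{1}{\mathrm{w}(s)}\sum_{v\in\mathcal{N}(s)}1_{\{v\in C\}}\right).$$ Then the weighted star estimator of the category edge weight $$\widehat{\mathrm{w}}(A,B)=\frac{\sum_{a\in S_A}\frac{|E_{a,B}|}{\mathrm{w}(a)}+\sum_{b\in S_B}\frac{|E_{b,A}|}{\mathrm{w}(b)}}{\mathrm{w}_{-1}(S_A)\cdot|\widehat{B}|+\mathrm{w}_{-1}(S_B)\cdot|\widehat{A}|}$$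 is consistent for the category edge weight $\mathrm{w}(A,B)=\dfrac{|E_{A,B}|}{|A|\cdot|B|}$, i.e. $\widehat{\mathrm{w}}(A,B)\to\mathrm{w}(A,B)$ in probability as $n\to\infty$.
   Context: $\mathrm{w}(v)$ (one node argument) is a sampling weight, whereas $\mathrm{w}(A,B)$ (two category arguments) is the category edge weight; they are unrelated functions. $E_{A,B}=\{\{u,v\}\in E: u\in A,\ v\in B\}$ is the edge-cut between $A$ and $B$; for a node $a$ and a category $B$, $E_{a,B}$ is the set of all edges of $G$ between $a$ and $B$. Weighted independence sampling (WIS): nodes are drawn independently and with replacement from $V$, node $v$ being drawn with probability $\pi(v)$ proportional to $\mathrm{w}(v)$; $S$ is the resulting multiset of $n=|S|$ nodes, and all sums over sub-multisets of $S$ count multiplicity. For a category $C$, $S_C=\{v\in S: v\in C\}$. For a multiset $X$ of nodes, $\mathrm{w}_{-1}(X)=\sum_{v\in X}\frac{1}{\mathrm{w}(v)}$. $\mathcal{N}(s)$ is the set of neighbors of $s$ and $\deg(s)$ is the degree of $s$. The assumptions made for consistency under non-uniform sampling are that the relevant means and variances are finite and that the sum of the weights is bounded, $\sum_{v\in V}\mathrm{w}(v)\le c$; both hold for finite graphs. $G$, $N$ and the weights are fixed. *)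

(* Defs.v *)
From HB Require Import structures.
From mathcomp Require Import all_boot all_order all_algebra.
From mathcomp Require Import all_classical all_reals all_analysis.

Set Implicit Arguments.
Unset Strict Implicit.
Unset Printing Implicit Defensive.

Import Order.TTheory GRing.Theory Num.Theory.
Import numFieldNormedType.Exports.

Local Open Scope classical_set_scope.
Local Open Scope ring_scope.

(* An undirected graph on the finite type V is given by a symmetric adjacency
   relation [adj].  Loops are not excluded: a loop at v is the edge [set v] and
   adds 1 to the degree of v. *)
Section Graph.
Variables (V : finType) (adj : rel V).

Definition edges : {set {set V}} :=
  [set E : {set V} |
    [exists u, [exists v, adj u v && (E == [set u; v]%SET)]]]%SET.

Definition edge_cut (A B : {set V}) : {set {set V}} :=
  [set E in edges | [exists u in A, [exists v in B, E == [set u; v]%SET]]]%SET.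

Definition neighbors (s : V) : {set V} := [set v | adj s v]%SET.

Definition degree (s : V) : nat := #|neighbors s|.

Definition category_edge_weight (R : realType) (A B : {set V}) : R :=
  #|edge_cut A B|%:R / (#|A|%:R * #|B|%:R).

End Graph.

(* A sample is a sequence of nodes, so repeated nodes count with multiplicity.
   All quotients follow the convention x / 0 = 0; this matters when a sample
   misses a category, and when no node of a category has a neighbor. *)
Section Estimators.
Variables (R : realType) (V : finType) (adj : rel V) (w : V -> R).
Implicit Types (S : seq V) (C : {set V}).

Definition restr S C : seq V := [seq v <- S | v \in C].

Definition winv S : R := \sum_(v <- S) (w v)^-1.

Definition wdeg S : R := \sum_(v <- S) (degree adj v)%:R / w v.

Definition induced_size S C : R := #|V|%:R * (winv (restr S C) / winv S).

Definition mean_degree S : R := wdeg S / winv S.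

Definition fvol S C : R :=
  (wdeg S)^-1 *
  \sum_(s <- S) ((w s)^-1 * \sum_(v in neighbors adj s) (v \in C)%:R).

Definition star_size S C : R :=
  #|V|%:R * fvol S C * (mean_degree S / mean_degree (restr S C)).

Inductive size_formula := Induced | Star.

Definition size_est (f : size_formula) : seq V -> {set V} -> R :=
  match f with Induced => induced_size | Star => star_size end.

(* [fA] and [fB] are the formulas plugged in for the sizes of A and B. *)
Definition edge_weight_est (fA fB : size_formula) (A B : {set V}) S : R :=
  (\sum_(a <- restr S A) #|edge_cut adj [set a]%SET B|%:R / w a +
   \sum_(b <- restr S B) #|edge_cut adj [set b]%SET A|%:R / w b) /
  (winv (restr S A) * size_est fB S B + winv (restr S B) * size_est fA S A).

End Estimators.

Section Sampling.
Variables (R : realType) (V : finType).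
Variables (d : measure_display) (Omega : measurableType d).
Variable P : probability Omega R.

Definition mutually_independent (X : nat -> Omega -> V) : Prop :=
  forall (J : seq nat) (F : nat -> set V), uniq J ->
    P (\bigcap_(i in [set` J]) X i @^-1` F i) =
    (\prod_(i <- J) P (X i @^-1` F i))%E.

(* V carries the discrete sigma-algebra; being finite, measurability of a
   V-valued map amounts to measurability of its fibers. *)
Record weighted_independence_sampling (w : V -> R) (X : nat -> Omega -> V)
    : Prop := {
  wis_measurable : forall i v, measurable (X i @^-1` [set v]);
  wis_law : forall i v, P (X i @^-1` [set v]) = (w v / \sum_u w u)%:E;
  wis_indep : mutually_independent X
}.

Definition sample (X : nat -> Omega -> V) (n : nat) (om : Omega) : seq V :=
  mkseq (fun i => X i om) n.

Definition cvg_in_probability (Y : nat -> Omega -> R) (l : R) : Prop :=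
  forall eps : R, 0 < eps ->
    P [set om | eps < `|Y n om - l|] @[n --> \oo] --> 0%E.

End Sampling.

(* Main.v *)
(* Divided by the sample size, every sum in the estimator is a linear function of
   the empirical node frequencies, so the estimator is a function of these
   frequencies alone.  When A and B are joined by an edge, both have positive
   volume, and the estimator is continuous at w(v) / W, W = \sum_v w v, with value
   |E_{A,B}| / (|A| |B|); otherwise it vanishes identically.  The frequencies
   converge in probability by Chebyshev's inequality, and a union bound over the
   finitely many nodes transfers this to the estimator. *)
Require Import Defs.
From HB Require Import structures.
From mathcomp Require Import all_boot all_order all_algebra.
From mathcomp Require Import all_classical all_reals all_analysis.
From mathcomp Require Import measurable_realfun ring.

Import Order.TTheory GRing.Theory Num.Theory.
Import numFieldNormedType.Exports.

Local Open Scope ring_scope.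

(** * Weak law for frequencies of pairwise independent events *)

Section WeakLaw.
Local Open Scope classical_set_scope.
Context {R : realType} {d : measure_display} {Omega : measurableType d}.
Context {P : probability Omega R}.

Lemma Lfun2_indic (A : set Omega) : measurable A -> (\1_A : Omega -> R) \in Lfun P 2%:E.
Proof.
move=> mA; rewrite inE; apply/andP; split; rewrite inE /=; first exact: measurable_indic.
rewrite /finite_norm unlock poweR_lty //.
under eq_integral => x _.
  rewrite /= indicE normr_nat powR_mulrn // -natrX -mulnn mulnb andbb -indicE.
  over.
by rewrite integral_indic // setIT (le_lt_trans (probability_le1 _ _)) // ltry.
Qed.

(** The product of two indicators is the indicator of the intersection. Hence independent events
    have uncorrelated indicators, and [A = B] yields the variance of an indicator. *)
Lemma covariance_indic (A B : set Omega) : measurable A -> measurable B ->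
  covariance P \1_A \1_B = (P (A `&` B) - P A * P B)%E.
Proof.
move=> mA mB; have [LA LB] := (Lfun2_indic _ mA, Lfun2_indic _ mB).
have L12 := Lfun_subset12 (fin_num_measure P _ (@measurableT _ Omega)).
rewrite (covarianceE (L12 _ LA) (L12 _ LB) (Lfun2_mul_Lfun1 LA LB)).
rewrite -[(\1_A * \1_B)%R]/(\1_A \* \1_B)%R -indicI.
by rewrite !expectation_indic //; apply: measurableI.
Qed.

Lemma Lfun2_sum (Y : nat -> Omega -> R) n :
  (forall i, Y i \in Lfun P 2%:E) -> \sum_(i < n) Y i \in Lfun P 2%:E.
Proof.
move=> LY; elim: n => [|n IHn]; first by rewrite big_ord0 (Lfun_cst P 0 2).
by rewrite big_ord_recr /= rpredD ?lee1n //= => _; exact: IHn.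
Qed.

Lemma variance_sum_uncorrelated (Y : nat -> Omega -> R) n :
  (forall i, Y i \in Lfun P 2%:E) ->
  (forall i j, i != j -> covariance P (Y i) (Y j) = 0%E) ->
  ('V_P[(\sum_(i < n) Y i)%R] = \sum_(i < n) 'V_P[Y i])%E.
Proof.
move=> LY cY; elim: n => [|n IHn].
  by rewrite !big_ord0 [X in variance _ X](_ : _ = cst 0) ?variance_cst.
rewrite !big_ord_recr /= varianceD ?Lfun2_sum // IHn.
suff -> : covariance P (\sum_(i < n) Y i) (Y n) = 0%E by rewrite mule0 adde0.
(* The partial sum gets its own bound [m], so that [Y n] stays fixed during the induction. *)
suff : forall m, (m <= n)%N -> covariance P (\sum_(i < m) Y i) (Y n) = 0%E by apply.
elim=> [_|m IHm mn].
  by rewrite big_ord0 [X in covariance _ X](_ : _ = cst 0) ?covariance_cst_l.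
by rewrite big_ord_recr /= covarianceDl ?Lfun2_sum // IHm ?(ltnW mn) // cY ?ltn_eqF ?adde0.
Qed.

(** Chebyshev's inequality for the sum of the indicators: its mean is [n p] and its variance at most
    [n], which gives [n / (e n)^2]. *)
Lemma event_frequency_deviation (A : nat -> set Omega) (p : R) n (e : R) :
  (forall i, measurable (A i)) -> (forall i, P (A i) = p%:E) ->
  (forall i j, i != j -> P (A i `&` A j) = (P (A i) * P (A j))%E) ->
  (0 < n)%N -> 0 < e ->
  (P [set om | (e <= `|(\sum_(i < n) \1_(A i) om) / n%:R - p|)%R] <=
   ((n%:R * e ^+ 2)^-1)%:E)%E.
Proof.
move=> mA PA indA n_gt0 e_gt0.
have n0 : 0 < n%:R :> R by rewrite ltr0n.
pose Y i : Omega -> R := \1_(A i).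
have LY i : Y i \in Lfun P 2%:E by exact: Lfun2_indic.
have mS : measurable_fun setT (\sum_(i < n) Y i).
  by have := Lfun2_sum _ n LY; rewrite inE => /andP[]; rewrite inE.
have ES : ('E_P[(\sum_(i < n) Y i)%R] = (n%:R * p)%:E)%E.
  rewrite -(big_map (fun i : 'I_n => Y i) xpredT id) expectation_sum; last first.
    move=> Z /mapP[i _ ->]; apply: Lfun_subset12 => //.
    exact: fin_num_measure.
  rewrite big_map (eq_bigr (fun=> p%:E)) => [|i _]; last first.
    by rewrite expectation_indic ?PA.
  by rewrite sumEFin sumr_const card_ord mulr_natl.
have VS : ('V_P[(\sum_(i < n) Y i)%R] <= (n%:R)%:E)%E.
  rewrite variance_sum_uncorrelated // => [|i j ij]; last first.
    by rewrite covariance_indic // indA // subee // fin_numM // PA.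
  apply: (@le_trans _ _ (\sum_(i < n) 1)%E); last first.
    by rewrite sumEFin sumr_const card_ord.
  (* Each indicator has variance [p - p^2], which is at most [p] and so at most 1. *)
  apply: lee_sum => i _; rewrite /variance covariance_indic // setIid PA.
  have := probability_le1 P (mA i); rewrite PA -EFinM -EFinB !lee_fin => p1.
  by rewrite (le_trans _ p1) // gerBl -expr2 sqr_ge0.
pose S : {RV P >-> R} := mfun_Sub (mem_set mS).
have := @chebyshev _ _ _ P S (e * n%:R) (mulr_gt0 e_gt0 n0).
have -> : ('E_P[S] = (n%:R * p)%:E)%E by [].
move=> H.
have -> : [set om | e <= `|(\sum_(i < n) \1_(A i) om) / n%:R - p|] =
  [set om | e * n%:R <= `|S om - fine (n%:R * p)%:E|].
  have eqS om : (\sum_(i < n) \1_(A i) om) / n%:R - p = (S om - n%:R * p) / n%:R.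
    rewrite -[S om]/((\sum_(i < n) Y i) om) fct_sumE.
    by rewrite mulrBl [n%:R * p]mulrC mulfK ?gt_eqF.
  apply/seteqP; split=> om /=;
    by rewrite eqS normf_div (gtr0_norm n0) ler_pdivlMr.
apply: le_trans H _.
apply: (@le_trans _ _ (((e * n%:R) ^- 2)%:E * (n%:R)%:E)%E).
  by apply: lee_wpmul2l => //; rewrite lee_fin invr_ge0 exprn_ge0 // mulr_ge0 // ltW.
rewrite -EFinM lee_fin exprMn [n%:R ^+ 2]expr2 mulrA invfM mulfVK ?gt_eqF //.
by rewrite mulrC.
Qed.

End WeakLaw.

(** * Counting edges by their end nodes *)

Definition volume {V : finType} (adj : rel V) (C : {set V}) : nat :=
  (\sum_(v in C) degree adj v)%N.

Section Graph.
Context {V : finType} {adj : rel V}.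
Hypothesis adj_sym : symmetric adj.

Lemma mem_edges u v : ([set u; v]%SET \in edges adj) = adj u v.
Proof.
rewrite inE; apply/existsP/idP => [[x /existsP[y /andP[axy /eqP e]]]|auv]; last first.
  by exists u; apply/existsP; exists v; rewrite auv eqxx.
have : x \in [set u; v]%SET by rewrite e set21.
have : y \in [set u; v]%SET by rewrite e set22.
have : u \in [set x; y]%SET by rewrite -e set21.
have : v \in [set x; y]%SET by rewrite -e set22.
rewrite !inE.
(* Equal unordered pairs agree up to a swap, and symmetry of [adj] absorbs the swap. *)
do 4![case/orP=> /eqP ?]; subst => //; by rewrite // adj_sym.
Qed.

(** Disjointness makes [(a, b) |-> {a, b}] injective on [A x B]: the end lying in [A] recovers the
    order. Cut edges thus correspond to adjacent ordered pairs. *)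
Lemma card_edge_cut (A B : {set V}) : [disjoint A & B] ->
  #|edge_cut adj A B| = (\sum_(a in A) \sum_(b in B) adj a b)%N.
Proof.
move=> dAB.
pose D := [set p : V * V | [&& p.1 \in A, p.2 \in B & adj p.1 p.2]]%SET.
have -> : edge_cut adj A B = [set ([set p.1; p.2]%SET : {set V}) | p in D]%SET.
  apply/setP => E; apply/idP/imsetP => [|[[a b]]].
    rewrite !inE => /andP[Eedge /exists_inP[a aA /exists_inP[b bB /eqP e]]].
    by exists (a, b) => //; rewrite inE /= aA bB -mem_edges -e inE.
  rewrite !inE /= => /and3P[aA bB ab] ->.
  have := mem_edges a b; rewrite ab inE => -> /=.
  by apply/exists_inP; exists a => //; apply/exists_inP; exists b.
rewrite card_in_imset => [|[a b] [a' b']]; last first.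
  rewrite !inE /= => /and3P[aA bB _] /and3P[a'A b'B _] e.
  have nAB x y : x \in A -> y \in B -> x != y.
    by move=> xA yB; apply: contraTneq yB => <-; rewrite (disjointFr dAB).
  have : a \in [set a'; b']%SET by rewrite -e set21.
  have : b \in [set a'; b']%SET by rewrite -e set22.
  rewrite !inE (negPf (nAB a b' _ _)) // orbF [b == a']eq_sym.
  by rewrite (negPf (nAB a' b _ _)) //= => /eqP-> /eqP->.
rewrite -sum1_card pair_big /= big_mkcond [RHS]big_mkcond.
by apply: eq_bigr => -[a b] _; rewrite inE /=; do 3!case: (_ \in _) || case: (adj _ _).
Qed.

Lemma edge_cutC (A B : {set V}) : edge_cut adj A B = edge_cut adj B A.
Proof.
apply/setP => E; rewrite !inE; congr (_ && _).
by apply/exists_inP/exists_inP => -[a aA /exists_inP[b bB e]]; exists b => //;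
  apply/exists_inP; exists a => //; rewrite finset.setUC.
Qed.

Lemma sum_card_edge_cut1 (A B : {set V}) : [disjoint A & B] ->
  (\sum_(a in A) #|edge_cut adj [set a]%SET B| = #|edge_cut adj A B|)%N.
Proof.
move=> dAB; rewrite (card_edge_cut _ _ dAB); apply: eq_bigr => a aA.
by rewrite card_edge_cut ?big_set1 // disjoints1 (disjointFr dAB).
Qed.

(** Double counting: after the sums are exchanged, each [v] in [C] is counted once per node adjacent
    to it, which by symmetry is its degree. This identifies the limit of the numerator of [fvol]. *)
Lemma sum_card_neighborsI (C : {set V}) :
  (\sum_s \sum_(v in neighbors adj s) (v \in C) = volume adj C)%N.
Proof.
under eq_bigr do rewrite big_mkcond; rewrite exchange_big /= [RHS]big_mkcond.
apply: eq_bigr => v _; rewrite /degree -sum1_card.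
case: (v \in C); last by rewrite big1 // => i _; case: ifP.
rewrite [RHS]big_mkcond; apply: eq_bigr => s _.
by rewrite !inE adj_sym; case: adj.
Qed.

Lemma volume_gt0 (A B : {set V}) :
  (0 < #|edge_cut adj A B|)%N -> (0 < volume adj A)%N.
Proof.
case/card_gt0P => E; rewrite inE => /andP[Eedge].
case/exists_inP=> a aA /exists_inP[b bB /eqP e].
rewrite /volume (bigD1 a) //= ltn_addr // card_gt0; apply/set0Pn; exists b.
by rewrite inE -mem_edges -e.
Qed.

End Graph.

(** * Empirical frequencies and limits along them *)

Section SampleFrequencies.
Local Open Scope classical_set_scope.

Definition freq {R : realType} {V : finType} (S : seq V) (v : V) : R :=
  (count_mem v S)%:R / (size S)%:R.

Definition freq_ball {R : realType} {V : finType} (law : V -> R) (e : R) :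
    set (seq V) :=
  [set S | (0 < size S)%N /\ forall v, `|freq S v - law v| < e].

(* Convergence of g along this filter is continuity of g at [law], as a function
   of the empirical frequencies of a nonempty sample. *)
Definition freq_nbhs {R : realType} {V : finType} (law : V -> R) :
    set_system (seq V) :=
  filter_from [set e : R | 0 < e] (freq_ball law).

Context {R : realType} {V : finType} {law : V -> R}.
Implicit Types S : seq V.

Global Instance freq_nbhs_filter : Filter (freq_nbhs law).
Proof.
apply: filter_from_filter; first by exists 1; rewrite /= ltr01.
move=> e1 e2 /= e1_gt0 e2_gt0.
exists (Num.min e1 e2); first by rewrite /= lt_min e1_gt0.
move=> S [S_gt0 fS]; split; split=> // v;
  by have := fS v; rewrite lt_min => /andP[].
Qed.

Lemma cvg_freq v : freq S v @[S --> freq_nbhs law] --> law v.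
Proof.
apply/cvgrPdist_lt => e e_gt0; exists e => // S [_ fS].
by rewrite /= distrC.
Qed.

Lemma sum_freq S (f : V -> R) :
  (\sum_(v <- S) f v) / (size S)%:R = \sum_v freq S v * f v.
Proof.
under [RHS]eq_bigr do rewrite /freq mulrAC.
rewrite -mulr_suml; congr (_ / _).
elim: S => [|x S IHS]; first by rewrite big_nil big1 // => v _; rewrite mul0r.
rewrite big_cons IHS /= [in RHS](eq_bigr (fun v =>
  (x == v)%:R * f v + (count_mem v S)%:R * f v)) => [|v _]; last first.
  by rewrite natrD mulrDl.
rewrite big_split /=; congr (_ + _); rewrite (bigD1 x) //= eqxx mul1r big1 ?addr0 // => v.
by rewrite eq_sym => /negPf->; rewrite mul0r.
Qed.

Lemma cvg_sample_mean (f : V -> R) :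
  (\sum_(v <- S) f v) / (size S)%:R @[S --> freq_nbhs law] --> \sum_v law v * f v.
Proof.
under eq_fun do rewrite sum_freq.
apply: cvg_big => [|v _]; first exact: add_continuous.
by apply: cvgM; [exact: cvg_freq | exact: cvg_cst].
Qed.

Lemma freq_nbhs_size_gt0 : \forall S \near freq_nbhs law, (0 < size S)%N.
Proof. by exists 1 => [|S []] //=; exact: ltr01. Qed.

(** The sample size cancels in the ratio because samples near [law] are nonempty. Only the
    normalized sums have limits, whereas the estimators are written with raw sums. *)
Lemma cvg_ratio (x y : seq V -> R) (a b : R) :
  x S / (size S)%:R @[S --> freq_nbhs law] --> a ->
  y S / (size S)%:R @[S --> freq_nbhs law] --> b -> b != 0 ->
  x S / y S @[S --> freq_nbhs law] --> a / b.
Proof.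
move=> xa yb b0.
have : (x S / (size S)%:R) * (y S / (size S)%:R)^-1 @[S --> freq_nbhs law] --> a / b.
  by apply: cvgM => //; exact: cvgV.
apply: cvg_trans; apply: near_eq_cvg.
apply: filterS freq_nbhs_size_gt0 => S S_gt0 /=.
by rewrite invf_div mulrA mulfVK // pnatr_eq0 -lt0n.
Qed.

(** * From frequency limits to convergence in probability *)

Context {d : measure_display} {Omega : measurableType d}.
Context {P : probability Omega R} {X : nat -> Omega -> V}.
Hypothesis mX : forall i v, measurable (X i @^-1` [set v]).
Hypothesis lawX : forall i v, P (X i @^-1` [set v]) = (law v)%:E.
Hypothesis indX : mutually_independent P X.

(** There are finitely many [n]-tuples over [V], so the event is a finite union of finite
    intersections of fibers, whatever [Q] is. *)
Lemma measurable_sample (Q : set (seq V)) n : measurable [set om | Q (sample X n om)].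
Proof.
have -> : [set om | Q (sample X n om)] =
    \bigcup_(t in [set t : n.-tuple V | Q t])
      \bigcap_(i in [set: 'I_n]) X i @^-1` [set tnth t i].
  apply/seteqP; split=> [om /= Qom|om [t /= Qt Xt]].
    exists [tuple X i om | i < n] => [|i _] /=; last by rewrite tnth_mktuple.
    suff -> : codom_tuple (fun i : 'I_n => X i om) = sample X n om :> seq V by [].
    by rewrite /sample /mkseq -val_enum_ord -map_comp.
  suff -> : sample X n om = t by [].
  rewrite /sample /mkseq -val_enum_ord -map_comp -[RHS]map_tnth_enum.
  by apply: eq_map => i; exact: (Xt i).
apply: fin_bigcup_measurable => [|t _]; first exact: finite_finset.
by apply: fin_bigcap_measurable => [|i _]; [exact: finite_finset | exact: mX].
Qed.

Lemma pairwise_independent i j v : i != j ->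
  P (X i @^-1` [set v] `&` X j @^-1` [set v]) =
  (P (X i @^-1` [set v]) * P (X j @^-1` [set v]))%E.
Proof.
move=> ij; have := indX [:: i; j] (fun=> [set v]).
rewrite /= inE ij big_cons big_seq1 => <- //; congr (P _).
apply/seteqP; split=> [om [/= Xi Xj] k|om Xom].
  by rewrite /= !inE => /orP[] /eqP->.
by split; apply: Xom; rewrite /= !inE eqxx ?orbT.
Qed.

Lemma freq_sample n v om :
  freq (sample X n om) v = (\sum_(i < n) \1_(X i @^-1` [set v]) om) / n%:R :> R.
Proof.
rewrite /freq /sample size_mkseq; congr (_ / _).
rewrite count_map -sum1_count natr_sum big_mkcond -val_enum_ord big_map.
rewrite big_enum /=; apply: eq_bigr => i _; rewrite indicE.
by rewrite (_ : (om \in _) = (X i om == v)); [case: eqP | apply/idP/eqP; rewrite inE].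
Qed.

Lemma freq_deviation n v (e : R) : (0 < n)%N -> 0 < e ->
  (P [set om | (e <= `|freq (sample X n om) v - law v|)%R] <=
   ((n%:R * e ^+ 2)^-1)%:E)%E.
Proof.
move=> n_gt0 e_gt0; under eq_set do rewrite freq_sample.
by apply: (event_frequency_deviation (fun i => X i @^-1` [set v])) => // i j;
  exact: pairwise_independent.
Qed.

(** Continuity provides a radius [e] such that an error of [g] above [eps] forces some node
    frequency to be off by at least [e]. The union bound then gives at most [#|V| / (n e^2)]. *)
Lemma cvg_sample_in_probability (g : seq V -> R) (l : R) :
  g @ freq_nbhs law --> l ->
  cvg_in_probability P (fun n om => g (sample X n om)) l.
Proof.
move=> /cvgrPdist_lt gl eps eps_gt0.
have [e /= e_gt0 ge] := gl _ eps_gt0.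
have bound n : (0 < n)%N ->
    (P [set om | (eps < `|g (sample X n om) - l|)%R] <=
     (#|V|%:R * e ^- 2 * n%:R^-1)%:E)%E.
  move=> n_gt0.
  have mdev v : measurable [set om | e <= `|freq (sample X n om) v - law v|].
    exact: (measurable_sample [set S | e <= `|freq S v - law v|] n).
  apply: (@le_trans _ _ (\sum_(v \in [set` enum V])
      P [set om | (e <= `|freq (sample X n om) v - law v|)%R])%E).
    apply: content_sub_fsum => [|v _||].
    - exact: finite_finset.
    - exact: mdev.
    - exact: (measurable_sample [set S | eps < `|g S - l|] n).
    - move=> om /= gom; apply: contrapT => /= H.
    have : freq_ball law e (sample X n om).
      split=> [|v]; first by rewrite size_mkseq.
      by rewrite ltNge; apply/negP => ev; apply: H; exists v; rewrite //= mem_enum.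
    move=> /ge /=; rewrite distrC ltNge => /negP; apply; exact: ltW.
  rewrite -fsbig_seq ?enum_uniq // big_enum /=; apply: (@le_trans _ _ (\sum_(v : V) ((n%:R * e ^+ 2)^-1)%:E)%E).
    by apply: lee_sum => v _; exact: freq_deviation.
  rewrite sumEFin sumr_const lee_fin invfM -[leLHS]mulr_natl.
  by rewrite (mulrC n%:R^-1) mulrA.
have lim0 : (#|V|%:R * e ^- 2 * n%:R^-1)%:E @[n --> \oo] --> (0 : R)%:E.
  apply: cvg_EFin; first exact: nearW.
  rewrite -[X in _ --> X](mulr0 (#|V|%:R * e ^- 2)).
  apply: cvgM; first exact: cvg_cst.
  (* The harmonic sequence is [1 / (n + 1)], hence the shift by one. *)
  rewrite -(cvg_shiftS (fun n => n%:R^-1 : R)).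
  exact: cvg_harmonic.
apply: (squeeze_cvge _ (cvg_cst 0%E) lim0).
by exists 1%N => // n /= n_gt0; rewrite measure_ge0 bound.
Qed.

End SampleFrequencies.

(** * Limits of the weighted estimators *)

Section Estimators.
Context {R : realType} {V : finType} {adj : rel V} {w : V -> R}.
Hypothesis adj_sym : symmetric adj.
Hypothesis w_gt0 : forall v, 0 < w v.
Local Open Scope classical_set_scope.
Implicit Types (C : {set V}) (S : seq V).

Let W : R := \sum_v w v.
Let pi_w v := w v / W.

Lemma restr_setT S : restr S [set: V]%SET = S.
Proof. by apply/all_filterP/allP => v _; rewrite inE. Qed.

(** The inverse weight cancels the sampling bias: [pi_w v * (c v / w v) = c v / W]. All sums in the
    estimators are instances, for suitable counts [c]. *)
Lemma cvg_weighted_sum C (c : V -> nat) :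
  (\sum_(v <- restr S C) (c v)%:R / w v) / (size S)%:R @[S --> freq_nbhs pi_w]
    --> (\sum_(v in C) c v)%:R / W.
Proof.
under eq_fun do rewrite big_filter big_mkcond.
have -> : (\sum_(v in C) c v)%:R / W =
    \sum_v pi_w v * (if v \in C then (c v)%:R / w v else 0).
  rewrite natr_sum mulr_suml big_mkcond; apply: eq_bigr => v _.
  case: ifP => _; last by rewrite mulr0.
  by rewrite [RHS]mulrC mulrA mulfVK ?gt_eqF.
exact: cvg_sample_mean.
Qed.

Lemma cvg_winv C :
  winv w (restr S C) / (size S)%:R @[S --> freq_nbhs pi_w] --> #|C|%:R / W.
Proof.
rewrite -sum1_card; have := cvg_weighted_sum C (fun=> 1%N).
by under eq_fun do under eq_bigr do rewrite mul1r.
Qed.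

Lemma cvg_wdeg C :
  wdeg adj w (restr S C) / (size S)%:R @[S --> freq_nbhs pi_w]
    --> (volume adj C)%:R / W.
Proof. exact: cvg_weighted_sum. Qed.

Lemma cvg_mean_degree C : W != 0 -> (0 < #|C|)%N ->
  mean_degree adj w (restr S C) @[S --> freq_nbhs pi_w]
    --> ((volume adj C)%:R / #|C|%:R : R).
Proof.
move=> W0 C0; have CW0 : #|C|%:R / W != 0.
  by rewrite mulf_neq0 ?invr_neq0 // pnatr_eq0 -lt0n.
have -> : (volume adj C)%:R / #|C|%:R =
    (volume adj C)%:R / W / (#|C|%:R / W) :> R.
  by rewrite invf_div mulrA mulfVK.
by apply: cvg_ratio CW0; [exact: cvg_wdeg | exact: cvg_winv].
Qed.

Lemma cvg_fvol C : W != 0 -> (0 < volume adj [set: V])%N ->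
  fvol adj w S C @[S --> freq_nbhs pi_w]
    --> ((volume adj C)%:R / (volume adj [set: V])%:R : R).
Proof.
move=> W0 D0; have DW0 : (volume adj [set: V])%:R / W != 0.
  by rewrite mulf_neq0 ?invr_neq0 // pnatr_eq0 -lt0n.
have -> : (volume adj C)%:R / (volume adj [set: V])%:R =
    (volume adj C)%:R / W / ((volume adj [set: V])%:R / W) :> R.
  by rewrite invf_div mulrA mulfVK.
under eq_fun do rewrite /fvol mulrC.
apply: cvg_ratio DW0; last first.
  by have := cvg_wdeg [set: V]%SET; under eq_fun do rewrite restr_setT.
(* The count attached to [s] is its number of neighbors in [C]; these add up to the volume of
   [C]. *)
have := cvg_weighted_sum [set: V]%SET
  (fun s => \sum_(v in neighbors adj s) (v \in C))%N.
rewrite (eq_bigl xpredT) => [|s]; last by rewrite inE.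
rewrite (sum_card_neighborsI adj_sym).
under eq_fun do rewrite restr_setT.
by under eq_fun do under eq_bigr do rewrite natr_sum mulrC.
Qed.

Lemma cvg_induced_size C : W != 0 -> (0 < #|V|)%N ->
  induced_size w S C @[S --> freq_nbhs pi_w] --> (#|C|%:R : R).
Proof.
move=> W0 V0; have V0' : #|V|%:R != 0 :> R by rewrite pnatr_eq0 -lt0n.
have -> : #|C|%:R = #|V|%:R * (#|C|%:R / W / (#|V|%:R / W)) :> R.
  by field; rewrite W0.
apply: cvgM; first exact: cvg_cst.
apply: cvg_ratio; [exact: cvg_winv | | by rewrite mulf_neq0 ?invr_neq0].
have := cvg_winv [set: V]%SET; rewrite cardsT.
by under eq_fun do rewrite restr_setT.
Qed.

Lemma cvg_star_size C : W != 0 -> (0 < #|C|)%N -> (0 < volume adj C)%N ->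
  star_size adj w S C @[S --> freq_nbhs pi_w] --> (#|C|%:R : R).
Proof.
move=> W0 C0 kC0.
have V0 : (0 < #|V|)%N by exact: leq_trans C0 (max_card _).
have D0 : (0 < volume adj [set: V])%N.
  apply: leq_trans kC0 _; rewrite /volume [leqLHS]big_mkcond.
  by rewrite [leqRHS]big_mkcond leq_sum // => v _; rewrite inE; case: ifP.
have [C0' kC0' V0' D0'] : [/\ #|C|%:R != 0 :> R, (volume adj C)%:R != 0 :> R,
    #|V|%:R != 0 :> R & (volume adj [set: V])%:R != 0 :> R].
  by split; rewrite pnatr_eq0 -lt0n.
(* The limits of the factors of [star_size]: the volumes and [#|V|] cancel and leave [#|C|]. The
   limit of the mean degree in [C] is inverted, so the volume of [C] must be nonzero. *)
have -> : #|C|%:R = #|V|%:R * ((volume adj C)%:R / (volume adj [set: V])%:R)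
    * ((volume adj [set: V])%:R / #|V|%:R / ((volume adj C)%:R / #|C|%:R)) :> R.
  by field; rewrite C0' kC0' V0'.
apply: cvgM.
  by apply: cvgM; [exact: cvg_cst | exact: cvg_fvol].
apply: cvgM; last first.
  apply: cvgV; last exact: cvg_mean_degree.
  by rewrite mulf_neq0 ?invr_neq0.
have := cvg_mean_degree [set: V]%SET W0; rewrite cardsT => /(_ V0).
by under eq_fun do rewrite restr_setT.
Qed.

Lemma cvg_size_est (f : size_formula) C :
  W != 0 -> (0 < #|C|)%N -> (0 < volume adj C)%N ->
  size_est adj w f S C @[S --> freq_nbhs pi_w] --> (#|C|%:R : R).
Proof.
move=> W0 C0 kC0; case: f; last exact: cvg_star_size.
by apply: cvg_induced_size => //; exact: leq_trans C0 (max_card _).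
Qed.

(* This case is separate because a category of volume 0 makes its star size
   estimate 0, through the convention x / 0 = 0, so consistency of the sizes fails. *)
Lemma edge_weight_est_eq0 (fA fB : size_formula) (A B : {set V}) S :
  [disjoint A & B]%B -> #|edge_cut adj A B| = 0%N ->
  edge_weight_est adj w fA fB A B S = 0.
Proof.
have E0 (A' B' : {set V}) : [disjoint A' & B']%B -> #|edge_cut adj A' B'| = 0%N ->
    \sum_(a <- restr S A') #|edge_cut adj [set a]%SET B'|%:R / w a = 0.
  move=> dAB /eqP; rewrite -(sum_card_edge_cut1 adj_sym) // sum_nat_eq0.
  move=> /forall_inP cut0; rewrite big_filter big1 // => a aA.
  by rewrite (eqP (cut0 a aA)) mul0r.
move=> dAB cut0; rewrite /edge_weight_est !E0 ?addr0 ?mul0r //.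
  by rewrite disjoint_sym.
by rewrite edge_cutC.
Qed.

Lemma cvg_edge_weight_est (fA fB : size_formula) (A B : {set V}) :
  [disjoint A & B]%B -> (0 < #|A|)%N -> (0 < #|B|)%N ->
  edge_weight_est adj w fA fB A B S @[S --> freq_nbhs pi_w]
    --> category_edge_weight adj R A B.
Proof.
move=> dAB A0 B0.
have [cut0|cut_gt0] := posnP #|edge_cut adj A B|.
  rewrite /category_edge_weight cut0 mul0r.
  by under eq_fun do rewrite edge_weight_est_eq0 //; exact: cvg_cst.
have W_gt0 : 0 < W.
  case/card_gt0P: A0 => a _; rewrite /W (bigD1 a) //=.
  by rewrite ltr_wpDr // sumr_ge0 // => v _; exact: ltW.
have W0 : W != 0 by rewrite gt_eqF.
have kA0 := volume_gt0 adj_sym A B cut_gt0.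
have kB0 : (0 < volume adj B)%N.
  by apply: (volume_gt0 adj_sym B A); rewrite edge_cutC.
have [A0' B0'] : #|A|%:R != 0 :> R /\ #|B|%:R != 0 :> R.
  by split; rewrite pnatr_eq0 -lt0n.
have cvg_cut (A' B' : {set V}) : [disjoint A' & B']%B ->
    (\sum_(a <- restr S A') #|edge_cut adj [set a]%SET B'|%:R / w a) / (size S)%:R
      @[S --> freq_nbhs pi_w] --> #|edge_cut adj A' B'|%:R / W.
  by move=> dAB'; rewrite -(sum_card_edge_cut1 adj_sym) //; exact: cvg_weighted_sum.
set E : R := #|edge_cut adj A B|%:R.
(* The sums over [A] and over [B] both see every cut edge, and both denominator terms tend to
   [#|A| * #|B| / W]; the resulting factor 2 and [W] cancel. *)
have -> : category_edge_weight adj R A B =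
    (E / W + E / W) / (#|A|%:R / W * #|B|%:R + #|B|%:R / W * #|A|%:R).
  rewrite /category_edge_weight -/E; field.
  by rewrite A0' B0' W0 andbT gt_eqF // addr_gt0 // mulr_gt0 ?ltr0n.
apply: cvg_ratio.
- under eq_fun do rewrite mulrDl.
  apply: cvgD; first exact: cvg_cut.
  by rewrite /E edge_cutC; apply: cvg_cut; rewrite disjoint_sym.
(* The division by the sample size is moved onto [winv], since the size estimates converge without
   normalization. *)
- under eq_fun do rewrite mulrDl mulrAC [X in _ + X]mulrAC.
  by apply: cvgD; apply: cvgM; (exact: cvg_winv || exact: cvg_size_est).
- by rewrite gt_eqF // addr_gt0 // mulr_gt0 ?divr_gt0 ?ltr0n.
Qed.

End Estimators.

Theorem mainTheorem8 (R : realType) (V : finType) (adj : rel V)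
  (cats : {set {set V}}) (A B : {set V}) (w : V -> R)
  (d : measure_display) (Omega : measurableType d) (P : probability Omega R)
  (X : nat -> Omega -> V) (fA fB : size_formula) :
  symmetric adj ->
  finset.partition cats [set: V]%SET ->
  A \in cats -> B \in cats -> A != B ->
  (forall v, 0 < w v) ->
  weighted_independence_sampling P w X ->
  cvg_in_probability P
    (fun n om => edge_weight_est adj w fA fB A B (sample X n om))
    (category_edge_weight adj R A B).
Proof.
move=> adj_sym /and3P[_ /finset.trivIsetP tI ne0] Acat Bcat AB w_gt0 [mX lawX indX].
(* A partition does not contain the empty set. *)
have nonempty C : C \in cats -> (0 < #|C|)%N.
  by move=> Ccat; rewrite card_gt0; apply: contraNneq ne0 => <-.
apply: (cvg_sample_in_probability mX lawX indX).
by apply: cvg_edge_weight_est => //; [exact: tI | exact: nonempty | exact: nonempty].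
Qed.
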